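(* Let $1\le c\le n-1$ and $-1\le\gamma<0$. For every graph $G$ of order $n$ with vertex connectivity $\kappa(G)=c$, \[{}^0R_{\gamma}(G)\ge c(n-1)^{\gamma}+(n-c-1)(n-2)^{\gamma}+c^{\gamma}.\] If $c=1$ and $\gamma=-1$, equality holds if and only if $G=K_1+(K_{n_1}\cup K_{n_2})$ for some $n_1,n_2\ge 1$ with $n_1+n_2=n-1$; if $c=1$ and $-1<\gamma<0$, or if $c\ge 2$, equality holds if and only if $G=K_c+(K_1\cup K_{n-c-1})$.
   Context: ${}^0R_{\gamma}(G)=\sum_{u\in V(G)} d(u)^{\gamma}$. All graphs are finite, simple and connected. A graph is $c$-connected if it is $K_{c+1}$ or has at least $c+2$ vertices and no vertex cut of size $c-1$; $\kappa(G)$ is the largest $c$ such that $G$ is $c$-connected. $G_1\cup G_2$ is the disjoint union and $G_1+G_2$ the join (disjoint union plus all edges between $V(G_1)$ and $V(G_2)$). $K_0$ is the empty graph, so $K_{n-1}+(K_1\cup K_0)=K_n$.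
   Formalization: In the case c=1, γ=−1 the equality characterization is stated for n≥3 only: for n=2 the graph K_2 attains the bound (reading 0·0^γ as 0) but no n_1,n_2≥1 satisfy n_1+n_2=1. *)

(* Defs.v *)
From HB Require Import structures.
From mathcomp Require Import all_boot all_order all_algebra.
From mathcomp Require Import reals exp.

Set Implicit Arguments.
Unset Strict Implicit.
Unset Printing Implicit Defensive.

Import Order.TTheory GRing.Theory Num.Theory.
Local Open Scope ring_scope.

Record sgraph := SGraph {
  vertex :> finType;
  adj : rel vertex;
  adj_sym : symmetric adj;
  adj_irrefl : irreflexive adj
}.
Arguments adj {s} _ _ : simpl never.

Definition graph_iso (G H : sgraph) : Prop :=
  exists2 f : G -> H, bijective f & forall x y, adj (f x) (f y) = adj x y.

Fact complete_sym n : symmetric (fun i j : 'I_n => i != j).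
Proof. by move=> i j; rewrite eq_sym. Qed.
Fact complete_irrefl n : irreflexive (fun i j : 'I_n => i != j).
Proof. by move=> i; rewrite eqxx. Qed.
Definition complete_graph (n : nat) : sgraph :=
  SGraph (@complete_sym n) (@complete_irrefl n).

Section UnionJoin.
Variables G H : sgraph.

Definition union_adj (x y : G + H) : bool :=
  match x, y with
  | inl a, inl b => adj a b
  | inr a, inr b => adj a b
  | _, _ => false
  end.
Fact union_sym : symmetric union_adj.
Proof. by move=> [a|a] [b|b] //=; rewrite adj_sym. Qed.
Fact union_irrefl : irreflexive union_adj.
Proof. by move=> [a|a] /=; rewrite adj_irrefl. Qed.
Definition graph_union : sgraph := SGraph union_sym union_irrefl.

Definition join_adj (x y : G + H) : bool :=
  match x, y with
  | inl a, inl b => adj a b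
  | inr a, inr b => adj a b
  | _, _ => true
  end.
Fact join_sym : symmetric join_adj.
Proof. by move=> [a|a] [b|b] //=; rewrite adj_sym. Qed.
Fact join_irrefl : irreflexive join_adj.
Proof. by move=> [a|a] /=; rewrite adj_irrefl. Qed.
Definition graph_join : sgraph := SGraph join_sym join_irrefl.
End UnionJoin.

Section Invariants.
Variable G : sgraph.

Definition degree (u : G) : nat := #|[set v | adj u v]|.

Definition graph_connected : bool :=
  [forall x : G, forall y : G, connect adj x y].

Definition is_complete : bool :=
  [forall x : G, forall y : G, (x != y) ==> adj x y].

Definition adj_minus (S : {set G}) : rel G :=
  [rel x y | [&& x \notin S, y \notin S & adj x y]].

Definition vertex_cut (S : {set G}) : bool :=
  [exists x : G, exists y : G,
    [&& x \notin S, y \notin S & ~~ connect (adj_minus S) x y]].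

(* The size condition is written #|S|.+1 = c so that c = 0 imposes nothing
   (there is no set of size -1). *)
Definition c_connected (c : nat) : bool :=
  ((#|G| == c.+1) && is_complete) ||
  ((c.+2 <= #|G|)%N &&
     [forall S : {set G}, (#|S|.+1 == c) ==> ~~ vertex_cut S]).

(* c_connected c forces c < #|G|, so this is the maximum over all c. *)
Definition kappa : nat := \max_(c < #|G| | c_connected c) c.

Definition general_zeroth_randic (R : realType) (gamma : R) : R :=
  \sum_(u : G) (degree u)%:R `^ gamma.
End Invariants.

(* Main.v *)
(** Fix a vertex cut S of size c and one component A of G - S; let B be the rest.
    Adding every edge not joining A to B lowers the index, since degrees are
    positive and gamma < 0, and gives K_c + (K_a u K_b), where a = |A| and
    b = |B|. Its index is c (n-1)^gamma + f a + f b with f t = t (t+c-1)^gamma,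
    and f is strictly concave on the positive integers unless c = 1 and
    gamma = -1, when it is constant; hence f 1 + f (a+b-1) <= f a + f b. *)
Require Import Defs.
From HB Require Import structures.
From mathcomp Require Import all_boot all_order all_algebra.
From mathcomp Require Import reals exp.
From mathcomp Require Import zify ring lra.

Set Implicit Arguments.
Unset Strict Implicit.
Unset Printing Implicit Defensive.

Import Order.TTheory GRing.Theory Num.Theory.
Local Open Scope ring_scope.

Section RealPowers.
Variable R : realType.
Implicit Types x y s q gamma : R.

Lemma lt_ln_subr1 x : 0 < x -> x != 1 -> ln x < x - 1.
Proof.
move=> x0 x1; rewrite -ltr_expR lnK ?posrE //.
have := @expR_gt1Dx R (x - 1); rewrite subr_eq0 => /(_ x1).
by rewrite addrC subrK.
Qed.

(* Jensen for [ln] at [x] and [1], with mean [w = q * x + (1 - q)]: add the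
   bounds [ln (x / w) < x / w - 1] and [ln w^-1 < w^-1 - 1] with weights
   [q] and [1 - q]. *)
Lemma powR_bernoulli_lt x q :
  0 < x -> x != 1 -> 0 < q < 1 -> x `^ q < 1 + q * (x - 1).
Proof.
move=> x0 x1 /andP[q0 q1].
set w := 1 + q * (x - 1).
have w0 : 0 < w by rewrite /w; nra.
have wi : 0 < w^-1 by rewrite invr_gt0.
have w1 : w != 1.
  by rewrite /w -subr_eq0 addrC addKr mulf_neq0 ?subr_eq0 // gt_eqF.
have xw : x * w^-1 != 1.
  apply/eqP => /(congr1 ( *%R^~ w)); rewrite mulfVK ?gt_eqF // mul1r => e.
  move/eqP: x1; apply; have : (x - 1) * (1 - q) = 0 by move: e; rewrite /w; lra.
  by move/eqP; rewrite mulf_eq0 => /orP[] /eqP; lra.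
have h1 := lt_ln_subr1 (mulr_gt0 x0 wi) xw.
have h2 : ln w^-1 < w^-1 - 1 by apply: lt_ln_subr1 => //; rewrite invr_eq1.
rewrite lnM ?posrE // lnV ?posrE // in h1.
rewrite lnV ?posrE // in h2.
have hw : q * (x * w^-1) + (1 - q) * w^-1 = 1.
  have -> : q * (x * w^-1) + (1 - q) * w^-1 = w * w^-1 by rewrite {3}/w; ring.
  by rewrite divff // gt_eqF.
rewrite -ltr_ln ?posrE ?powR_gt0 // ln_powR.
nra.
Qed.

Lemma powR_bernoulli x q : 0 < x -> 0 < q <= 1 -> x `^ q <= 1 + q * (x - 1).
Proof.
move=> x0 /andP[q0]; rewrite le_eqVlt => /orP[/eqP -> | q1].
  by rewrite (powRr1 (ltW x0)) mul1r addrC subrK.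
have [-> | x1] := eqVneq x 1; first by rewrite powR1 subrr mulr0 addr0.
by apply/ltW/powR_bernoulli_lt; rewrite ?q0.
Qed.

Lemma powR_negE s y gamma : 0 < s -> 0 < y ->
  y `^ gamma = s `^ gamma * (s / y) `^ (- gamma).
Proof.
move=> s0 y0; rewrite powRM ?invr_ge0 ?ltW // mulrA -powRD ?(gt_eqF s0) ?implybT //.
rewrite subrr powRr0 mul1r -(powR_inv1 (ltW y0)) -powRrM; congr (_ `^ _); ring.
Qed.

Lemma powR_neg_bound s y gamma : 0 < s -> 0 < y -> -1 <= gamma < 0 ->
  y `^ gamma <= s `^ gamma * (1 - gamma * (s / y - 1)).
Proof.
move=> s0 y0 /andP[g1 g0]; rewrite (@powR_negE s y) // ler_pM2l ?powR_gt0 //.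
by rewrite -mulNr powR_bernoulli ?divr_gt0 //; lra.
Qed.

Lemma powR_neg_bound_lt s y gamma : 0 < s -> 0 < y -> y != s ->
  -1 < gamma < 0 -> y `^ gamma < s `^ gamma * (1 - gamma * (s / y - 1)).
Proof.
move=> s0 y0 ys /andP[g1 g0]; rewrite (@powR_negE s y) // ltr_pM2l ?powR_gt0 //.
rewrite -mulNr powR_bernoulli_lt ?divr_gt0 //; last by lra.
by rewrite -(divr1 1) eqr_div ?oner_eq0 ?(gt_eqF y0) // mulr1 mul1r eq_sym.
Qed.

Lemma lt_powR_neg x y gamma : 0 < x -> gamma < 0 -> x < y ->
  y `^ gamma < x `^ gamma.
Proof.
move=> x0 g0 xy; have y0 := lt_trans x0 xy.
rewrite -ltr_ln ?posrE ?powR_gt0 // !ln_powR ltr_nM2l //.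
by rewrite ltr_ln ?posrE.
Qed.

Definition part_weight (gamma : R) (k t : nat) : R :=
  t%:R * (t + k)%:R `^ gamma.

Lemma part_weight_concave gamma k t : -1 <= gamma < 0 ->
  (-1 < gamma) || (0 < k)%N -> (0 < t)%N ->
  part_weight gamma k t + part_weight gamma k t.+2
    < part_weight gamma k t.+1 *+ 2.
Proof.
move=> hg strict t0; have /andP[g1 g0] := hg; rewrite /part_weight.
set x : R := t%:R; set s : R := (t.+1 + k)%:R; set z : R := k%:R.
have x1 : 1 <= x by rewrite ler1n.
have z0 : 0 <= z by rewrite ler0n.
have zk : (0 < k)%N -> 0 < z by rewrite ltr0n.
have sE : s = x + 1 + z by rewrite /s natrD -natr1.
have -> : (t + k)%:R = s - 1 :> R by rewrite sE natrD -/x -/z; lra.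
have -> : (t.+2 + k)%:R = s + 1 :> R.
  by rewrite sE natrD -!natr1 -/x -/z; lra.
have -> : t.+2%:R = x + 2 :> R by rewrite -!natr1 -/x; lra.
have -> : t.+1%:R = x + 1 :> R by rewrite -natr1.
clearbody x s z.
have s0 : 0 < s by lra.
have sm : 0 < s - 1 by lra.
have sp : 0 < s + 1 by lra.
have P0 : 0 < s `^ gamma by rewrite powR_gt0.
have Hm := @powR_neg_bound s (s - 1) gamma s0 sm hg.
have Hp := @powR_neg_bound s (s + 1) gamma s0 sp hg.
have Em : s / (s - 1) - 1 = (s - 1)^-1 by field; rewrite (gt_eqF sm).
have Ep : s / (s + 1) - 1 = - (s + 1)^-1 by field; rewrite (gt_eqF sp).
rewrite Em in Hm; rewrite Ep in Hp.
pose D := (x + 2) / (s + 1) - x / (s - 1).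
have DE : D = 2 * z / ((s + 1) * (s - 1)).
  by rewrite /D sE; field; apply/andP; split; apply/eqP; lra.
have D0 : 0 <= D by rewrite DE divr_ge0 ?mulr_ge0 //; lra.
have Sum : x * (s `^ gamma * (1 - gamma * (s - 1)^-1)) +
   (x + 2) * (s `^ gamma * (1 - gamma * - (s + 1)^-1))
   = (x + 1) * s `^ gamma *+ 2 + s `^ gamma * gamma * D.
  by rewrite /D; ring.
have Hm' := ler_wpM2l (le_trans ler01 x1) Hm.
have x2 : 0 < x + 2 by lra.
have [gt|gle] := ltP (-1) gamma.
  have := @powR_neg_bound_lt s (s + 1) gamma s0 sp.
  rewrite gt_eqF ?gt ?ltrDl // => /(_ isT g0).
  rewrite Ep -(ltr_pM2l x2) => Hp'.
  apply: lt_le_trans (ler_ltD Hm' Hp') _.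
  rewrite Sum gerDl -mulrA; have : gamma * D <= 0 by nra.
  by rewrite (pmulr_rle0 _ P0).
move: strict; rewrite ltNge gle /= => k0.
have z1 := zk k0.
have Dp : 0 < D by rewrite DE divr_gt0 ?mulr_gt0 //; lra.
rewrite -(ler_pM2l x2) in Hp.
apply: le_lt_trans (lerD Hm' Hp) _.
by rewrite Sum gtrDl -mulrA pmulr_rlt0 // nmulr_rlt0.
Qed.

Lemma concave_seq_lt (g : nat -> R) i j :
  (forall m, g m + g m.+2 < g m.+1 *+ 2) -> (0 < i)%N -> (0 < j)%N ->
  g 0%N + g (i + j)%N < g i + g j.
Proof.
move=> gconc i0 j0.
have step m p : (0 < p)%N -> g (m + p).+1 - g (m + p)%N < g m.+1 - g m.
  elim: p => // p IH _; have := gconc (m + p)%N; rewrite addnS.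
  case: p IH => [|p] IH; first by rewrite addn0; lra.
  by have := IH isT; lra.
elim: i i0 => // i IH _; have := step i j j0; rewrite addSn.
case: i IH => [|i] IH; first by rewrite !add0n; lra.
by have := IH isT; lra.
Qed.

Lemma part_weight_lt gamma k a b : -1 <= gamma < 0 ->
  (-1 < gamma) || (0 < k)%N -> (1 < a)%N -> (1 < b)%N ->
  part_weight gamma k 1 + part_weight gamma k (a + b).-1
    < part_weight gamma k a + part_weight gamma k b.
Proof.
case: a b => [|a] [|b] // hg strict a1 b1; rewrite addSn addnS /=.
apply: (@concave_seq_lt (fun m => part_weight gamma k m.+1)) => // m.
exact: part_weight_concave.
Qed.

Lemma part_weightN1 t : (0 < t)%N -> part_weight (-1) 0 t = 1.
Proof.
move=> t0; rewrite /part_weight addn0 powR_inv1 ?ler0n //.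
by rewrite divff // pnatr_eq0 -lt0n.
Qed.

(* The case [b = 0] arises from complete graphs. *)
Lemma part_weight_le gamma k a b : -1 <= gamma < 0 ->
  (0 < a)%N -> (0 < b)%N || (a == 1)%N ->
  part_weight gamma k 1 + part_weight gamma k (a + b).-1
    <= part_weight gamma k a + part_weight gamma k b.
Proof.
move=> hg a0 hb.
have [-> | a1] := eqVneq a 1%N; first by [].
rewrite (negbTE a1) orbF in hb.
have [-> | b1] := eqVneq b 1%N; first by rewrite addn1 addrC.
have [strict | flat] := boolP ((-1 < gamma) || (0 < k)%N).
  by apply/ltW/part_weight_lt => //; lia.
move: flat; rewrite negb_or -leNgt -eqn0Ngt => /andP[g1 /eqP ->].
have -> : gamma = -1 by apply/eqP; rewrite eq_le g1; case/andP: hg.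
by rewrite !part_weightN1 //; lia.
Qed.

End RealPowers.

Section Degrees.
Implicit Types G H : sgraph.

Lemma degreeE G (u : G) : degree u = (\sum_v adj u v)%N.
Proof.
rewrite /degree -sum1_card big_mkcond.
by apply: eq_bigr => v; rewrite inE; case: adj.
Qed.

Lemma degree_complete n (i : complete_graph n) : degree i = n.-1.
Proof.
rewrite /degree (_ : [set v | adj i v] = [set~ i]) ?cardsC1 ?card_ord //.
by apply/setP => j; rewrite !inE eq_sym.
Qed.

Lemma degree_joinl G H (u : G) :
  degree (inl u : graph_join G H) = (degree u + #|H|)%N.
Proof.
by rewrite !degreeE big_sumType /= sum1_card.
Qed.

Lemma degree_joinr G H (u : H) :
  degree (inr u : graph_join G H) = (#|G| + degree u)%N.
Proof.
by rewrite !degreeE big_sumType /= sum1_card.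
Qed.

Lemma degree_unionl G H (u : G) : degree (inl u : graph_union G H) = degree u.
Proof.
by rewrite !degreeE big_sumType /= [X in (_ + X)%N]big1 ?addn0.
Qed.

Lemma degree_unionr G H (u : H) : degree (inr u : graph_union G H) = degree u.
Proof.
by rewrite !degreeE big_sumType /= [X in (X + _)%N]big1 ?add0n.
Qed.

Lemma degree_gt0 G (u : G) :
  graph_connected G -> (1 < #|G|)%N -> (0 < degree u)%N.
Proof.
move=> /forallP/(_ u)/forallP conn; rewrite (cardD1 u) inE ltnS => /card_gt0P[v].
rewrite !inE andbT => vu; have /connectP[[|w p] /=] := conn v.
  by move=> _ vE; rewrite vE eqxx in vu.
by case/andP=> uw _ _; apply/card_gt0P; exists w; rewrite inE.
Qed.

Variables (R : realType) (gamma : R).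

Lemma randic_iso G H : graph_iso G H ->
  general_zeroth_randic G gamma = general_zeroth_randic H gamma.
Proof.
case=> f bf fadj; rewrite /general_zeroth_randic [RHS](reindex f) /=; last first.
  exact: onW_bij.
apply: eq_bigr => u _; congr (_%:R `^ _).
rewrite !degreeE [RHS](reindex f) /=; last exact: onW_bij.
by apply: eq_bigr => v _; rewrite fadj.
Qed.

Lemma randic_join_cliques k a b :
  general_zeroth_randic (graph_join (complete_graph k.+1)
    (graph_union (complete_graph a) (complete_graph b))) gamma
  = k.+1%:R * (k + a + b)%:R `^ gamma
    + (part_weight gamma k a + part_weight gamma k b).
Proof.
rewrite /general_zeroth_randic big_sumType /=.
rewrite big_sumType /=.
congr (_ + (_ + _)).
- under eq_bigr do rewrite degree_joinl degree_complete card_sum !card_ord addnA.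
  by rewrite sumr_const card_ord mulr_natl.
- rewrite (eq_bigr (fun=> (a + k)%:R `^ gamma)) => [|i _].
    by rewrite sumr_const card_ord /part_weight mulr_natl.
  rewrite degree_joinr degree_unionl degree_complete card_ord.
  by have := ltn_ord i; move=> ?; congr (_%:R `^ _); lia.
- rewrite (eq_bigr (fun=> (b + k)%:R `^ gamma)) => [|i _].
    by rewrite sumr_const card_ord /part_weight mulr_natl.
  rewrite degree_joinr degree_unionr degree_complete card_ord.
  by have := ltn_ord i; move=> ?; congr (_%:R `^ _); lia.
Qed.

Lemma randic_spanning_subgraph (T : finType) (e e' : rel T) es ei es' ei' :
  let G := @SGraph T e es ei in let H := @SGraph T e' es' ei' in
  gamma < 0 -> (forall u : G, (0 < degree u)%N) -> subrel e e' ->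
  general_zeroth_randic H gamma <= general_zeroth_randic G gamma
    ?= iff [forall u, forall v, e u v == e' u v].
Proof.
move=> G H g0 dpos sub; apply: (leif_sum (C := fun u => [forall v, e u v == e' u v])) => u _.
have sN : [set v | e u v] \subset [set v | e' u v].
  by apply/subsetP => v; rewrite !inE; exact: sub.
have dE : degree (u : G) = #|[set v | e u v]| by [].
have dE' : degree (u : H) = #|[set v | e' u v]| by [].
have [eqN | neqN] := boolP [forall v, e u v == e' u v].
  suff -> : degree (u : H) = degree (u : G) by apply/leif_refl.
  by rewrite dE dE'; apply: eq_card => v; rewrite !inE (eqP (forallP eqN v)).
have lt : (degree (u : G))%:R `^ gamma > (degree (u : H))%:R `^ gamma.
  apply: lt_powR_neg => //; rewrite ?ltr0n // ltr_nat dE dE' proper_card //.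
  rewrite properEneq sN andbT; apply: contra neqN => /eqP/setP eqN.
  by apply/forallP => v; have := eqN v; rewrite !inE => ->.
by split; [exact: ltW | rewrite (lt_eqF lt)].
Qed.

End Degrees.

Section Labellings.
Variables (T : finType).
Implicit Types l : T -> option bool.

(* A labelling marks cut vertices by [None] and the two sides by [Some _]. *)
Definition sep_compat (p q : option bool) : bool :=
  [|| p == None, q == None | p == q].

Definition sep_adj l : rel T :=
  fun u v => (u != v) && sep_compat (l u) (l v).

Lemma sep_adj_sym l : symmetric (sep_adj l).
Proof.
move=> u v; rewrite /sep_adj /sep_compat eq_sym [l v == l u]eq_sym.
by rewrite orbCA.
Qed.

Lemma sep_adj_irrefl l : irreflexive (sep_adj l).
Proof. by move=> u; rewrite /sep_adj eqxx. Qed.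

Definition sep_graph l : sgraph := SGraph (sep_adj_sym l) (sep_adj_irrefl l).

Definition label_class l p : {set T} := [set u | l u == p].

Lemma card_label_classes l :
  (#|label_class l None| + #|label_class l (Some true)|
    + #|label_class l (Some false)|)%N = #|T|.
Proof.
rewrite -!sum1dep_card (big_mkcond (fun u => l u == None)).
rewrite (big_mkcond (fun u => l u == Some true)).
rewrite (big_mkcond (fun u => l u == Some false)) -!big_split /= -sum1_card.
by apply: eq_bigr => u _; case: (l u) => [[]|].
Qed.

Lemma label_enum_val l p (i : 'I_#|label_class l p|) : l (enum_val i) = p.
Proof. by have := enum_valP i; rewrite inE => /eqP. Qed.

Lemma sep_graph_iso l :
  graph_iso (sep_graph l)
    (graph_join (complete_graph #|label_class l None|)
       (graph_union (complete_graph #|label_class l (Some true)|)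
                    (complete_graph #|label_class l (Some false)|))).
Proof.
set H := graph_join _ _.
pose g (x : H) : T := match x with
  | inl i => enum_val i
  | inr (inl i) => enum_val i
  | inr (inr i) => enum_val i
  end.
have gadj x y : sep_adj l (g x) (g y) = adj x y.
  by move: x y => [i|[i|i]] [j|[j|j]];
    rewrite /sep_adj /sep_compat /g !label_enum_val /= ?andbT ?andbF
            ?(inj_eq enum_val_inj) //;
    apply/eqP => /(congr1 l); rewrite !label_enum_val.
have ginj : injective g.
  by move=> [i|[i|i]] [j|[j|j]] /= eg;
    try (by have := congr1 l eg; rewrite !label_enum_val);
    rewrite (enum_val_inj eg).
have [f gf fg] : bijective g.
  apply: inj_card_bij ginj _.
  by rewrite !card_sum !card_ord addnA card_label_classes.
exists f; first by exists g.
by move=> u v; rewrite -gadj !fg.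
Qed.

Lemma label_class_negb l b :
  label_class (omap negb \o l) (Some b) = label_class l (Some (~~ b)).
Proof. by apply/setP => u; rewrite !inE /=; case: (l u) => [[]|]; case: b. Qed.

Lemma label_class_negbN l :
  label_class (omap negb \o l) None = label_class l None.
Proof. by apply/setP => u; rewrite !inE /=; case: (l u) => [[]|]. Qed.

Lemma sep_adj_negb l : sep_adj (omap negb \o l) =2 sep_adj l.
Proof.
move=> u v; rewrite /sep_adj /sep_compat /=.
by case: (l u) => [[]|]; case: (l v) => [[]|].
Qed.

End Labellings.

Section Cuts.
Variable G : sgraph.

Lemma kappa_connected : (0 < kappa G)%N -> c_connected G (kappa G).
Proof.
move=> k0; have [i0 Pi0 | none] := pickP (fun i : 'I_#|G| => c_connected G i).
  by rewrite /kappa (bigop.bigmax_eq_arg i0) //; case: arg_maxnP.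
by move: k0; rewrite /kappa big_pred0.
Qed.

Lemma kappa_max c : (c < #|G|)%N -> c_connected G c -> (c <= kappa G)%N.
Proof. by move=> cG hc; apply: (leq_bigmax_cond (Ordinal cG)). Qed.

Lemma complete_sub_kappa : is_complete G -> (#|G|.-1 <= kappa G)%N.
Proof.
move=> cG; have [->//|G0] := posnP #|G|.
by apply: kappa_max; rewrite ?prednK // /c_connected prednK // eqxx cG.
Qed.

Lemma vertex_cut_nonadjacent (x y : G) :
  x != y -> ~~ adj x y -> vertex_cut (~: [set x; y]).
Proof.
move=> xy nxy; apply/existsP; exists x; apply/existsP; exists y.
rewrite !inE !eqxx orbT /=; apply/connectP => -[p].
have no_step z : ~~ adj_minus (~: [set x; y]) x z.
  rewrite /adj_minus /= !inE !negbK; apply/and3P => -[_ /orP[]/eqP->].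
    by rewrite adj_irrefl.
  by rewrite (negbTE nxy).
case: p => [_ /= yx|z p /= /andP[xz _] _]; first by rewrite yx eqxx in xy.
by have := no_step z; rewrite /= xz.
Qed.

Lemma min_vertex_cut : (0 < kappa G)%N -> ~~ is_complete G ->
  exists2 S : {set G}, #|S| = kappa G & vertex_cut S.
Proof.
move=> k0 ncG; have := kappa_connected k0; rewrite {1}/c_connected.
rewrite (negbTE ncG) andbF /= => /andP[kG _].
have : ~~ c_connected G (kappa G).+1.
  by apply/negP => /(kappa_max kG); rewrite ltnn.
rewrite /c_connected (negbTE ncG) andbF /= negb_and -ltnNge.
case/orP=> [Gk | /forallPn[S]]; last first.
  by rewrite negb_imply negbK eqSS => /andP[/eqP ? ?]; exists S.
have GE : #|G| = (kappa G).+2 by apply/eqP; rewrite eqn_leq kG andbT.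
move: ncG => /forallPn[x /forallPn[y]]; rewrite negb_imply => /andP[xy nxy].
exists (~: [set x; y]); last exact: vertex_cut_nonadjacent.
by have := cardsC [set x; y]; rewrite cards2 xy GE => -[].
Qed.

Lemma vertex_cut_labelling (S : {set G}) : vertex_cut S ->
  exists l : G -> option bool,
    [/\ label_class l None = S, (0 < #|label_class l (Some true)|)%N,
        (0 < #|label_class l (Some false)|)%N & subrel adj (sep_adj l)].
Proof.
case/existsP=> x /existsP[y /and3P[xS yS nxy]].
pose l u := if u \in S then None else Some (connect (adj_minus S) x u).
exists l; split.
- by apply/setP => u; rewrite inE /l; case: (u \in S).
- by apply/card_gt0P; exists x; rewrite inE /l (negbTE xS) connect0.
- by apply/card_gt0P; exists y; rewrite inE /l (negbTE yS) (negbTE nxy).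
move=> u v uv; rewrite /sep_adj; apply/andP; split.
  by apply: contraL uv => /eqP->; rewrite adj_irrefl.
rewrite /sep_compat /l; case: ifPn => // uS; case: ifPn => // vS; apply/eqP.
congr Some; apply/idP/idP => /connect_trans; apply; apply: connect1.
  by rewrite /adj_minus /= uS vS.
by rewrite /adj_minus /= uS vS adj_sym.
Qed.

Lemma kappa_labelling : (0 < kappa G < #|G|)%N ->
  exists l : G -> option bool,
    [/\ #|label_class l None| = kappa G, (0 < #|label_class l (Some true)|)%N,
        (0 < #|label_class l (Some false)|)%N
          || (#|label_class l (Some true)| == 1)%N
        & subrel adj (sep_adj l)].
Proof.
case/andP=> k0 kG; have [cG | ncG] := boolP (is_complete G); last first.
  have [S SE /vertex_cut_labelling[l [lS lt lf sub]]] := min_vertex_cut k0 ncG.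
  by exists l; rewrite lS lt lf.
have /card_gt0P[x _] := leq_ltn_trans (leq0n _) kG.
pose l u := if u == x then Some true else None.
have lE : label_class l (Some true) = [set x].
  by apply/setP => u; rewrite !inE /l; case: (eqVneq u x).
have lN : label_class l None = [set~ x].
  by apply/setP => u; rewrite !inE /l; case: (eqVneq u x).
exists l; rewrite lE lN cards1 orbT cardsC1; split=> //.
  by have := complete_sub_kappa cG; lia.
move=> u v uv; have uNv : u != v.
  by apply: contraL uv => /eqP->; rewrite adj_irrefl.
rewrite /sep_adj uNv /sep_compat /l /=.
by case: (eqVneq u x) => // ux; case: (eqVneq v x) => // vx; rewrite ux vx eqxx in uNv.
Qed.

End Cuts.

Theorem theorem3p6 (R : realType) (n c : nat) (gamma : R)
    (hc : (1 <= c <= n - 1)%N) (hgamma : -1 <= gamma < 0)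
    (G : sgraph) (hconn : graph_connected G)
    (hn : #|G| = n) (hkappa : kappa G = c) :
  let bound := c%:R * (n - 1)%:R `^ gamma
               + (n - c - 1)%:R * (n - 2)%:R `^ gamma + c%:R `^ gamma in
  [/\ bound <= general_zeroth_randic G gamma,
      c = 1%N -> gamma = -1 -> (3 <= n)%N ->
        (general_zeroth_randic G gamma = bound <->
         exists n1 n2 : nat,
           [/\ (1 <= n1)%N, (1 <= n2)%N, (n1 + n2 = n - 1)%N &
               graph_iso G (graph_join (complete_graph 1)
                 (graph_union (complete_graph n1) (complete_graph n2)))])
    & (c = 1%N /\ -1 < gamma) \/ (2 <= c)%N ->
        (general_zeroth_randic G gamma = bound <->
         graph_iso G (graph_join (complete_graph c)
           (graph_union (complete_graph 1) (complete_graph (n - c - 1)))))].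
Proof.
move=> bound.
have kG : (0 < kappa G < #|G|)%N by rewrite hkappa hn; lia.
have [l [lN a0 hb sub]] := kappa_labelling kG.
have cards := card_label_classes l.
have isoH := sep_graph_iso l.
move: isoH a0 hb cards.
move cardt: #|label_class l (Some true)| => a.
move cardf: #|label_class l (Some false)| => b.
rewrite hkappa in lN; rewrite lN hn => isoH a0 hb cards.
case: c hc hkappa lN isoH cards @bound => // k hc hkappa lN isoH cards bound.
have /andP[g1 g0] := hgamma.
have boundE : bound = k.+1%:R * (n - 1)%:R `^ gamma +
    (part_weight gamma k 1 + part_weight gamma k (a + b).-1).
  rewrite /bound -addrA [X in _ = _ + X]addrC; congr (_ + (_ + _)).
    rewrite /part_weight -cards; congr (_%:R * _); first by lia.
    have [ab1|ab1] := leqP (a + b) 1; last by congr (_%:R `^ _); lia.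
    by congr (_%:R `^ _); lia.
  by rewrite /part_weight mul1r add1n.
have dpos (u : G) : (0 < degree u)%N.
  by apply: degree_gt0 => //; rewrite hn; lia.
have [leGH eqGH] : general_zeroth_randic (sep_graph l) gamma
    <= general_zeroth_randic G gamma
    ?= iff [forall u, forall v, adj u v == sep_adj l u v].
  case: G hconn hn hkappa kG l lN isoH sub cardt cardf dpos {boundE bound cards}
    => T e es ei _ _ _ _ l _ _ sub _ _ dpos.
  exact: randic_spanning_subgraph.
have HE : general_zeroth_randic (sep_graph l) gamma
   = k.+1%:R * (n - 1)%:R `^ gamma
     + (part_weight gamma k a + part_weight gamma k b).
  rewrite (randic_iso _ isoH) randic_join_cliques -cards.
  by congr (_ * _%:R `^ _ + _); lia.
have wle := part_weight_le k hgamma a0 hb.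
have boundH : bound <= general_zeroth_randic (sep_graph l) gamma.
  by rewrite boundE HE lerD2l.
have boundG := le_trans boundH leGH.
have forced : general_zeroth_randic G gamma = bound ->
    general_zeroth_randic (sep_graph l) gamma = bound
    /\ forall u v : G, adj u v = sep_adj l u v.
  move=> eqG; have eqH : general_zeroth_randic (sep_graph l) gamma = bound.
    by apply/eqP; rewrite eq_le boundH -eqG leGH.
  split=> // u v; move: eqGH; rewrite eqG eqH eqxx => /esym/forallP/(_ u).
  by move=> /forallP/(_ v)/eqP.
split=> //.
- move=> [k0] gN1 n3; subst k; split.
    move=> /forced[_ adjE]; exists a, b; split=> //; try lia.
    case: isoH => f bf fadj; exists f => // u v; rewrite fadj; exact/esym/adjE.
  case=> n1 [n2 [n10 n20 n12 /(@randic_iso R gamma) ->]].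
  rewrite randic_join_cliques boundE gN1 !part_weightN1 //; last by lia.
  by congr (_ * _%:R `^ _ + _); lia.
move=> strict; have hs : (-1 < gamma) || (0 < k)%N.
  by case: strict => [[_ ->]|k0] //; apply/orP; right; lia.
split; last first.
  move=> /(@randic_iso R gamma) ->; rewrite randic_join_cliques boundE.
  by congr (_ * _%:R `^ _ + (_ + part_weight _ _ _)); lia.
move=> /forced[eqH adjE].
have : (a == 1)%N || (b == 1)%N.
  apply/norP => -[a1 b1]; move: hb; rewrite (negbTE a1) orbF => b0.
  have a2 : (1 < a)%N by rewrite ltn_neqAle eq_sym a1.
  have b2 : (1 < b)%N by rewrite ltn_neqAle eq_sym b1.
  have /lt_eqF := part_weight_lt hgamma hs a2 b2.
  by move: eqH; rewrite HE boundE => /addrI ->; rewrite eqxx.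
case/orP => /eqP e1.
  have bE : b = (n - k.+1 - 1)%N by lia.
  rewrite e1 bE in isoH.
  case: isoH => f bf fadj; exists f => // u v; rewrite fadj; exact/esym/adjE.
have aE : a = (n - k.+1 - 1)%N by lia.
have := sep_graph_iso (omap negb \o l).
rewrite label_class_negbN !label_class_negb /= cardt cardf lN e1 aE.
case=> f bf fadj; exists f => // u v; rewrite fadj adjE; exact: sep_adj_negb.
Qed.
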